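(* Let $I\subset\mathbb{R}$ be an open interval and let $x,y,r:I\to\mathbb{R}$ be smooth functions with $r(s)>0$ and $x'(s)^2+y'(s)^2+r'(s)^2=1$ for all $s\in I$ (so $s$ is an arc-length parameter of the profile curve $\gamma(s)=(x(s),y(s),r(s))$ in $\mathbb{E}^3$). Consider the simple rotational surface in the four-dimensional Euclidean space $\mathbb{E}^4$ given by \[ X(s,\theta)=\bigl(x(s),\,y(s),\,r(s)\cos\theta,\,r(s)\sin\theta\bigr),\qquad (s,\theta)\in I\times\mathbb{R}. \] If the surface is biharmonic, i.e. its mean curvature vector $\mathbf{H}$ satisfies $\Delta\mathbf{H}=0$, then the surface is minimal, i.e. $\mathbf{H}\equiv 0$.
   Context: The surface carries the induced metric $g=ds^2+r(s)^2d\theta^2$, and $\Delta$ denotes its Laplace–Beltrami operator acting componentwise on $\mathbb{E}^4$-valued functions: $\Delta Y=\frac1r\partial_s(r\,\partial_sY)+\frac1{r^2}\partial_\theta^2Y$. The mean curvature vector is $\mathbf{H}=\frac12\Delta X$. Biharmonic means $\Delta\mathbf{H}=0$ identically on the surface; no completeness or properness of the immersion is assumed (the statement is local). *)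

(* Defs.v *)
From Stdlib Require Import Reals.
From Coquelicot Require Import Coquelicot.
Open Scope R_scope.

Definition in_interval (a b : Rbar) (s : R) : Prop :=
  Rbar_lt a s /\ Rbar_lt s b.

Definition smooth_on (a b : Rbar) (f : R -> R) : Prop :=
  forall (n : nat) (s : R), in_interval a b s -> ex_derive_n f n s.

Definition dS (F : R -> R -> R) (s th : R) : R := Derive (fun t => F t th) s.
Definition dT (F : R -> R -> R) (s th : R) : R := Derive (fun t => F s t) th.

(* Laplace-Beltrami operator of g = ds^2 + r(s)^2 dtheta^2, on scalar functions:
   Delta Y = (1/r) d_s (r d_s Y) + (1/r^2) d_theta^2 Y. *)
Definition lapl (r : R -> R) (F : R -> R -> R) (s th : R) : R :=
  / r s * dS (fun s' th' => r s' * dS F s' th') s th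
  + / (r s ^ 2) * dT (dT F) s th.

Definition Xc (x y r : R -> R) (i : nat) (s th : R) : R :=
  match i with
  | O => x s
  | 1%nat => y s
  | 2%nat => r s * cos th
  | _ => r s * sin th
  end.

(* i-th coordinate of the mean curvature vector H = (1/2) Delta X. *)
Definition Hc (x y r : R -> R) (i : nat) (s th : R) : R :=
  / 2 * lapl r (Xc x y r i) s th.

(* Main.v *)
(** Write [u = (r x')'/r], [v = (r y')'/r], [w = ((r r')' - 1)/r]; up to a factor 1/2 the
    mean curvature vector is (u, v, w cos, w sin).  In the conformal parameter t, dt = ds/r,
    biharmonicity reads u_tt = v_tt = 0, w_tt = w.  So (u,v) is affine in t and
    w = A e^t + B e^-t, while x_tt = r^2 u, y_tt = r^2 v, r_tt = r^2 w + r.  Differentiating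
    the arc-length relation x_t^2 + y_t^2 + r_t^2 = r^2 repeatedly gives equations that express
    (x_t, y_t) and r_t rationally in r; substituting them back yields two polynomial equations
    F = G = 0 for r, with coefficients polynomial in t, e^t and e^-t.

    If (u,v) is not constant and A <> 0, set p = r e^t and h = e^(-2t).  The resultant of F
    and G in p is a polynomial in t and h vanishing on the curve h = e^(-2t), hence it is 0.
    But at h = 0, t = 1 the two polynomials are coprime: F becomes a multiple of
    P^2 (4 P^2 + 7 P + 2), P = A p, which has only real roots, and e G is there a positive
    combination of squares without common zero with F (t is normalised so that
    u^2 + v^2 = e t^2 + c with c >= 0).  The case B <> 0 follows by reversing t.  If
    A = B = 0, then F reduces to a nontrivial polynomial equation for t alone.  If (u,v) is
    constant, eliminating r leaves a nontrivial polynomial equation for w, so w is constant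
    and hence 0, and then u = v = 0. *)

Require Import Defs.
From Stdlib Require Import Reals Lra Lia List FunctionalExtensionality.
From Coquelicot Require Import Coquelicot.
From mathcomp Require all_boot all_order all_algebra ring Rstruct.
Open Scope R_scope.

(** * The two eliminants *)

(* [n], [m], [e] stand for the inner products of U = (u,v) and U_t with themselves:
   n = |U|^2, m = U . U_t, e = |U_t|^2.  With N = u^2 + v^2 + w^2 and M = N_t / 2, the
   ODE for r is [r_t = - r sg / (2 K)]. *)
Definition Fval (n m e w w1 r : R) : R :=
  let N := w ^ 2 + n in let M := w * w1 + m in
  let K := N * r + w in let sg := 3 * M * r + 2 * w1 in
  N * r * sg ^ 2 - sg * (10 * M * r + 4 * w1) * K
  + 2 * K ^ 2 * (2 * w * N * r ^ 2
      + (2 * N + 2 * w ^ 2 + 3 * (e + w1 ^ 2 + w ^ 2)) * r + 4 * w).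

Definition Gval (n m e w w1 r : R) : R :=
  let N := w ^ 2 + n in let M := w * w1 + m in
  let K := N * r + w in let sg := 3 * M * r + 2 * w1 in
  (2 * K ^ 2 - w1 * sg) ^ 2 * n + 2 * w * sg * (2 * K ^ 2 - w1 * sg) * m
  + w ^ 2 * sg ^ 2 * e - (n * e - m ^ 2) * (4 * K ^ 2 - sg ^ 2).

(* [F] and [G] are homogeneous when n, m, e have weight 2, w and w1 weight 1, r weight -1. *)
Lemma Fval_scale (n m e w w1 r z : R) : z <> 0 ->
  Fval n m e w w1 r =
  z ^ 3 * Fval (n / z ^ 2) (m / z ^ 2) (e / z ^ 2) (w / z) (w1 / z) (r * z).
Proof. intros Hz; unfold Fval; field; exact Hz. Qed.

Lemma Gval_scale (n m e w w1 r z : R) : z <> 0 ->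
  Gval n m e w w1 r =
  z ^ 6 * Gval (n / z ^ 2) (m / z ^ 2) (e / z ^ 2) (w / z) (w1 / z) (r * z).
Proof. intros Hz; unfold Gval; field; exact Hz. Qed.

(* MathComp is imported only inside this module: its [<] on [nat] would change the
   meaning of the theorem.  Inside, numerals are ring elements, so constants and operations
   of the real numbers of Stdlib are written [IZR Z0], [Rmult], etc. *)
Module Elimination.

Import all_boot all_order all_algebra Rstruct.
Import Order.TTheory GRing.Theory Num.Theory.
Local Open Scope ring_scope.

(** * Polynomials in t and e^(-2t) that vanish near a point *)

(* For a polynomial Phi in h (outer variable) and t, this is the derivative of
   Phi(e^(-2t), t) with respect to t. *)
Definition expD (Phi : {poly {poly R}}) : {poly {poly R}} :=
  map_poly (@deriv R) Phi - (Phi^`() * 'X) *+ 2.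

(** Since h^i stands for e^(-2it), [expD] is diagonal in the powers of h; the vanishing argument
    below rests on this. *)
Lemma coef_expD Phi i : (expD Phi)`_i = (Phi`_i)^`() - (Phi`_i) *+ (2 * i).
Proof.
rewrite coefB coefMn coefMX coef_map_id0 ?deriv0 //.
case: i => [|i] /=; first by rewrite mul0rn muln0.
by rewrite coef_deriv -mulrnA mulnC.
Qed.

Lemma is_derive_horner (c : {poly R}) (t : R -> R) (s l : R) :
  is_derive t s l -> is_derive (fun s => c.[t s]) s (c^`().[t s] * l).
Proof.
move=> dt; elim/poly_ind: c => [|c a IH].
  rewrite deriv0 horner0 mul0r.
  apply: (@is_derive_ext R_AbsRing R_NormedModule (fun _ => IZR Z0)) => [u|].
    by rewrite horner0.
  exact: (@is_derive_const R_AbsRing R_NormedModule).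
apply: (@is_derive_ext R_AbsRing R_NormedModule (fun s => Rplus (Rmult (c.[t s]) (t s)) a)) => [u|].
  by rewrite hornerMXaddC.
have -> : (c * 'X + a%:P)^`().[t s] * l
   = Rplus (Rplus (Rmult (c^`().[t s] * l) (t s)) (Rmult (c.[t s]) l)) (IZR Z0).
  rewrite derivMXaddC hornerD hornerM hornerX; move: (c.[t s]) (c^`().[t s]) => u v.
  (* The MathComp operations on [R] are convertible to those of Stdlib, and this [ring] is the
     Stdlib tactic. *)
  change (Rmult (Rplus u (Rmult v (t s))) l =
    Rplus (Rplus (Rmult (Rmult v l) (t s)) (Rmult u l)) (IZR Z0)); ring.
apply: (@is_derive_plus R_AbsRing R_NormedModule); last exact: (@is_derive_const R_AbsRing R_NormedModule).
apply: (is_derive_mult (fun s => c.[t s]) t s _ l IH dt) => x y; exact: Rmult_comm.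
Qed.

Lemma is_derive_eq_near0 (f : R -> R) (s l : R) :
  is_derive f s l -> locally s (fun s => f s = 0) -> l = 0.
Proof.
move=> df f0.
have df' : is_derive (fun _ => IZR Z0) s l by apply: is_derive_ext_loc df.
by rewrite -[LHS](is_derive_unique _ _ _ df') Derive_const.
Qed.

(** Differentiating c(t(s)) = 0 and cancelling t' <> 0 shows that c' vanishes along t as well.
    Induction on the size gives c' = 0, and then c is a constant that has a zero. *)
Lemma poly_vanish_near (c : {poly R}) (t t1 : R -> R) (s0 : R) :
  locally s0 (fun s => is_derive t s (t1 s) /\ t1 s <> 0 /\ c.[t s] = 0) -> c = 0.
Proof.
elim: {c}(size c) {-2}c (leqnn (size c)) => [|n IH] c cn H.
  by apply/eqP; rewrite -size_poly_leq0.
have c'0 : c^`() = 0.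
  apply: IH.
    have [->|c0] := eqVneq c 0; first by rewrite deriv0 size_poly0.
    by rewrite -ltnS; apply: leq_trans (lt_size_deriv c0) cn.
  apply: filter_imp (locally_locally _ _ H) => s Hs.
  have [ds [t0 _]] := locally_singleton _ _ Hs; split=> //; split=> //.
  have : c^`().[t s] * t1 s = 0.
    apply: (is_derive_eq_near0 (fun s => c.[t s]) s); first exact: is_derive_horner.
    by apply: filter_imp Hs => u [_ []].
  by move/eqP; rewrite mulf_eq0 => /orP[] /eqP.
have cC : c = (c`_0)%:P.
  apply/polyP => -[|i]; rewrite coefC //=.
  have := congr1 (fun p : {poly R} => p`_i) c'0.
  rewrite coef_deriv coef0 => /eqP.
  by rewrite mulrn_eq0 /= => /eqP.
have [_ [_]] := locally_singleton _ _ H.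
by rewrite cC hornerC => ->.
Qed.

Lemma is_derive_exp_poly (Phi : {poly {poly R}}) (t : R -> R) (s l : R) :
  is_derive t s l ->
  is_derive (fun s => Phi.[(exp (Rmult (IZR (-2)) (t s)))%:P].[t s]) s
    ((expD Phi).[(exp (Rmult (IZR (-2)) (t s)))%:P].[t s] * l).
Proof.
move=> dt; elim/poly_ind: Phi => [|Phi c IH].
  rewrite /expD deriv0 map_poly0 mul0r mul0rn subr0 !horner0 mul0r.
  apply: (@is_derive_ext R_AbsRing R_NormedModule (fun _ => IZR Z0)) => [u|].
    by rewrite !horner0.
  exact: (@is_derive_const R_AbsRing R_NormedModule).
pose h s := exp (Rmult (IZR (-2)) (t s)).
apply: (@is_derive_ext R_AbsRing R_NormedModule
  (fun s => Rplus (Rmult (Phi.[(h s)%:P].[t s]) (h s)) (c.[t s]))) => [u|].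
  by rewrite hornerMXaddC !hornerE.
have dh : is_derive h s (Rmult (Rmult (IZR (-2)) l) (h s)).
  rewrite /h; auto_derive; first exact: (ex_intro _ l dt).
  by rewrite (is_derive_unique t s l dt); ring.
have -> : expD (Phi * 'X + c%:P) =
  expD Phi * 'X - (Phi * 'X) *+ 2 + (c^`())%:P.
  apply/polyP => i; rewrite !(coef_expD, coefD, coefN, coefMn, coefMX, coefC).
  case: i => [|i] /=; first by rewrite muln0 !mulr0n addr0 !subr0 !add0r.
  by rewrite !addr0 mulnS mulrnDr opprD addrA addrAC.
move: (expD Phi) IH => E IH.
have -> : (E * 'X - (Phi * 'X) *+ 2 + (c^`())%:P).[(exp (Rmult (IZR (-2)) (t s)))%:P].[t s] * l
  = Rplus (Rplus (Rmult (E.[(h s)%:P].[t s] * l) (h s))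
             (Rmult (Phi.[(h s)%:P].[t s]) (Rmult (Rmult (IZR (-2)) l) (h s))))
          (c^`().[t s] * l).
  rewrite -/(h s) !(hornerD, hornerN, hornerMn, hornerM, hornerX, hornerC).
  have aux (u v w z : R) : (u * w - (v * w + v * w) + z) * l =
      Rplus (Rplus (Rmult (Rmult u l) w) (Rmult v (Rmult (Rmult (IZR (-2)) l) w))) (Rmult z l).
    change (Rmult (Rplus (Rplus (Rmult u w) (Ropp (Rplus (Rmult v w) (Rmult v w)))) z) l =
      Rplus (Rplus (Rmult (Rmult u l) w) (Rmult v (Rmult (Rmult (IZR (-2)) l) w))) (Rmult z l)).
    by ring.
  exact: aux.
apply: (@is_derive_plus R_AbsRing R_NormedModule); last exact: is_derive_horner.
apply: (is_derive_mult (fun s => Phi.[(h s)%:P].[t s]) h s _ _ IH dh) => x y; exact: Rmult_comm.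
Qed.

(* Iterating [expD] kills the coefficient of h^0 but none of the others, so one may then
   divide by h and induct on the degree in h. *)
Lemma exp_poly_vanish_near (Phi : {poly {poly R}}) (t t1 : R -> R) (s0 : R) :
  locally s0 (fun s => is_derive t s (t1 s) /\ t1 s <> 0 /\
    Phi.[(exp (Rmult (IZR (-2)) (t s)))%:P].[t s] = 0) -> Phi = 0.
Proof.
elim: {Phi}(size Phi) {-2}Phi (leqnn (size Phi)) => [|n IH] Phi Pn H.
  by apply/eqP; rewrite -size_poly_leq0.
have Hk k : locally s0 (fun s => is_derive t s (t1 s) /\ t1 s <> 0 /\
    (iter k expD Phi).[(exp (Rmult (IZR (-2)) (t s)))%:P].[t s] = 0).
  elim: k => [|k IHk] //=.
  apply: filter_imp (locally_locally _ _ IHk) => s Hs.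
  have [ds [t0 _]] := locally_singleton _ _ Hs; split=> //; split=> //.
  have := is_derive_eq_near0 _ _ _ (is_derive_exp_poly (iter k expD Phi) _ _ _ ds) _.
  move=> E; have {E} : (expD (iter k expD Phi)).[(exp (Rmult (IZR (-2)) (t s)))%:P].[t s] * t1 s = 0.
    by apply: E; apply: filter_imp Hs => u [_ []].
  by move/eqP; rewrite mulf_eq0 => /orP[] /eqP.
have iterC k : (iter k expD Phi)`_0 = (Phi`_0)^`(k).
  by elim: k => //= k IHk; rewrite coef_expD muln0 mulr0n subr0 IHk.
have size_iter k : (size (iter k expD Phi) <= n.+1)%N.
  elim: k => //= k IHk; apply/leq_sizeP => j nj.
  by rewrite coef_expD (leq_sizeP _ _ IHk j nj) deriv0 mul0rn subr0.
(* A polynomial is annihilated by as many derivatives as its size, so h divides the k-th iterate. *)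
pose k := size (Phi`_0).
have k0 : (iter k expD Phi)`_0 = 0 by rewrite iterC derivn_poly0.
pose Psi := drop_poly 1 (iter k expD Phi).
have PsiE : iter k expD Phi = Psi * 'X.
  rewrite -[LHS](poly_take_drop 1) expr1; set q := take_poly _ _.
  suff -> : q = 0 by rewrite add0r.
  by apply/polyP => -[|i]; rewrite coef_take_poly coef0 //= k0.
have Psi0 : Psi = 0.
  apply: IH; first by rewrite size_drop_poly leq_subLR add1n.
  apply: filter_imp (Hk k) => s [ds [t0]]; split=> //; split=> //.
  move: b; rewrite PsiE hornerMX hornerM hornerC => /eqP; rewrite mulf_eq0.
  case/orP => /eqP // e0.
  by have := exp_pos (Rmult (IZR (-2)) (t s)); rewrite e0 => /Rlt_irrefl.
(* If c' = 2 (i + 1) c with c <> 0, the leading coefficient of c would survive in c', whose degree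
   is smaller. This injectivity carries vanishing coefficients of the iterate back to [Phi]. *)
have step0 (c : {poly R}) i : c^`() - c *+ (2 * i.+1) = 0 -> c = 0.
  move/eqP; rewrite subr_eq0 => /eqP E.
  have [//|c0] := eqVneq c 0.
  have : (c^`())`_(size c).-1 = 0.
    by apply: nth_default; rewrite -ltnS prednK ?size_poly_gt0 // lt_size_deriv.
  rewrite E coefMn => /eqP.
  by rewrite mulrn_eq0 muln_eq0 /= -lead_coefE lead_coef_eq0 (negPf c0).
have Pi i : Phi`_i.+1 = 0.
  have : (iter k expD Phi)`_i.+1 = 0 by rewrite PsiE Psi0 mul0r coef0.
  elim: (k) => //= j IHj; rewrite coef_expD => /step0; exact: IHj.
have PhiC : Phi = (Phi`_0)%:P by apply/polyP => -[|i]; rewrite coefC //= Pi.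
rewrite PhiC; congr (_%:P); apply: (poly_vanish_near _ t t1 s0).
by apply: filter_imp H => s; rewrite {1}PhiC hornerC.
Qed.

(** * Common roots and the resultant *)

Import ring.

(** The resultant in p is a combination of f and g, so it vanishes on the curve h = e^(-2t), hence
    identically. It may therefore be evaluated at h = 0, off the curve; as the leading coefficients
    survive there, specialisation commutes with the resultant, and its vanishing contradicts
    coprimality. *)
Lemma no_common_root_near (f g : {poly {poly {poly R}}}) (t0 : R) (t t1 : R -> R) (s0 : R) :
  (1 < size f)%N -> (1 < size g)%N ->
  (lead_coef f).[0].[t0] != 0 -> (lead_coef g).[0].[t0] != 0 ->
  coprimep (map_poly (horner_eval t0 \o horner_eval 0) f)
    (map_poly (horner_eval t0 \o horner_eval 0) g) ->
  locally s0 (fun s => is_derive t s (t1 s) /\ t1 s <> 0 /\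
    exists p : R, f.[p%:P%:P].[(exp (Rmult (IZR (-2)) (t s)))%:P].[t s] = 0 /\
                  g.[p%:P%:P].[(exp (Rmult (IZR (-2)) (t s)))%:P].[t s] = 0) -> False.
Proof.
move=> sf sg lf lg cop H.
have [[u v] /= _ E] := resultant_in_ideal sf sg.
have res0 : resultant f g = 0.
  apply: (exp_poly_vanish_near _ t t1 s0).
  apply: filter_imp H => s [ds [t0s [p [fp gp]]]]; split=> //; split=> //.
  have := congr1 (fun q => q.[p%:P%:P].[(exp (Rmult (IZR (-2)) (t s)))%:P].[t s]) E.
  by rewrite /= hornerC !(hornerD, hornerM) fp gp !mulr0 addr0.
have := @map_resultant _ _ (horner_eval t0 \o horner_eval 0) f g lf lg.
rewrite res0 rmorph0 => /esym/eqP; rewrite resultant_eq0.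
by rewrite /coprimep in cop; rewrite (eqP cop).
Qed.

(* [Fval] and h^-1 [Gval] at the rescaled arguments P = r e^t, H = e^(-2t), over any
   commutative ring, for |U|^2 = e T^2 + c and U . U_t = e T. *)
Section Eliminants.
Context {S : comNzRingType}.
Variables e c A B P T H : S.

Definition Felim : S :=
  let n := e * T ^+ 2 + c in let m := e * T in
  let w := A + B * H in let w1 := A - B * H in
  let N := w ^+ 2 + n * H in let M := w * w1 + m * H in
  let k := N * P + w in let s := 3%:R * M * P + 2%:R * w1 in
  N * P * s ^+ 2 - s * (10%:R * M * P + 4%:R * w1) * k
  + 2%:R * k ^+ 2 * (2%:R * w * N * P ^+ 2
      + (2%:R * N + 2%:R * w ^+ 2 + 3%:R * (e * H + w1 ^+ 2 + w ^+ 2)) * P + 4%:R * w).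

Definition Gelim : S :=
  let n := e * T ^+ 2 + c in let m := e * T in
  let w := A + B * H in let w1 := A - B * H in
  let N := w ^+ 2 + n * H in let M := w * w1 + m * H in
  let k := N * P + w in let s := 3%:R * M * P + 2%:R * w1 in
  (2%:R * k ^+ 2 - w1 * s) ^+ 2 * n + 2%:R * w * s * (2%:R * k ^+ 2 - w1 * s) * m
  + w ^+ 2 * s ^+ 2 * e - e * c * H * (4%:R * k ^+ 2 - s ^+ 2).

End Eliminants.

Section Morph.
Context {S S' : comNzRingType} (f : {rmorphism S -> S'}).

(** The eliminants use ring operations only. Hence one generic polynomial yields both the
    specialisation at h = 0, t = 1 and the evaluation on the curve. *)
Lemma rmorph_Felim e c A B P T H :
  f (Felim e c A B P T H) = Felim (f e) (f c) (f A) (f B) (f P) (f T) (f H).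
Proof. by rewrite /Felim /= !(rmorph_nat, rmorphXn, rmorphD, rmorphN, rmorphM). Qed.

Lemma rmorph_Gelim e c A B P T H :
  f (Gelim e c A B P T H) = Gelim (f e) (f c) (f A) (f B) (f P) (f T) (f H).
Proof. by rewrite /Gelim /= !(rmorph_nat, rmorphXn, rmorphD, rmorphN, rmorphM). Qed.
End Morph.

Section DegreeBounds.
Context {S : comNzRingType}.
Implicit Types p q : {poly S}.

Definition deg_le (n : nat) p := (size p <= n.+1)%N.

Lemma deg_leC (a : S) : deg_le 0 a%:P. Proof. exact: size_polyC_leq1. Qed.
Lemma deg_le_nat n : deg_le 0 n%:R. Proof. by rewrite -polyC_natr deg_leC. Qed.
Lemma deg_leX : deg_le 1 'X. Proof. by rewrite /deg_le size_polyX. Qed.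
Lemma deg_leN n p : deg_le n p -> deg_le n (- p).
Proof. by rewrite /deg_le size_polyN. Qed.
Lemma deg_leD i j p q : deg_le i p -> deg_le j q -> deg_le (maxn i j) (p + q).
Proof.
move=> pi qj; apply: leq_trans (size_polyD _ _) _; rewrite -maxnSS geq_max !leq_max.
by apply/andP; split; apply/orP; [left|right].
Qed.
Lemma deg_leM i j p q : deg_le i p -> deg_le j q -> deg_le (i + j) (p * q).
Proof.
move=> pi qj; apply: leq_trans (size_polyMleq _ _) _.
by rewrite -subn1 leq_subLR add1n -addSn -addnS leq_add.
Qed.
Lemma deg_leX2 i p : deg_le i p -> deg_le (i + i) (p ^+ 2).
Proof. by rewrite expr2 => pi; apply: deg_leM. Qed.

Ltac deg_le_tac := repeat first
  [ apply: deg_leC | apply: deg_le_nat | apply: deg_leX | apply: deg_leN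
  | apply: deg_leX2 | apply: deg_leD | apply: deg_leM ].

Lemma deg_Felim (e c A B T H : S) :
  deg_le 4 (Felim e%:P c%:P A%:P B%:P 'X T%:P H%:P).
Proof.
suff [n] : exists2 n, deg_le n (Felim e%:P c%:P A%:P B%:P 'X T%:P H%:P) & (n <= 4)%N.
  by rewrite /deg_le => Hn n4; apply: leq_trans Hn _.
(* The bound is an existential variable that the degree rules fill in from the syntax; its
   comparison with 4 is then a computation. *)
eexists; first by rewrite /Felim /=; deg_le_tac.
by [].
Qed.

Lemma deg_Gelim (e c A B T H : S) :
  deg_le 4 (Gelim e%:P c%:P A%:P B%:P 'X T%:P H%:P).
Proof.
suff [n] : exists2 n, deg_le n (Gelim e%:P c%:P A%:P B%:P 'X T%:P H%:P) & (n <= 4)%N.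
  by rewrite /deg_le => Hn n4; apply: leq_trans Hn _.
eexists; first by rewrite /Gelim /=; deg_le_tac.
by [].
Qed.

(** At H = 0 one has w = w1 = A and N = M = A^2, so P enters only through q = A P once powers of A
    are factored out. *)
Lemma Felim0 (e c A B P T : S) : Felim e c A B P T 0 =
  A ^+ 3 * (A * P) ^+ 2 * (4%:R * (A * P) ^+ 2 + 7%:R * (A * P) + 2%:R).
Proof. rewrite /Felim /=; ring. Qed.

Lemma Gelim0 (e c A B P T : S) : Gelim e c A B P T 0 =
  let q := A * P in let a := 2%:R * q ^+ 2 + q in let b := 3%:R * q + 2%:R in
  A ^+ 4 * (a ^+ 2 * (e * T ^+ 2 + c) + 2%:R * a * b * (e * T) + b ^+ 2 * e).
Proof. rewrite /Gelim /=; ring. Qed.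

End DegreeBounds.

(** A coefficient with nonzero image is nonzero; sitting at the degree bound, it is the leading
    one. *)
Lemma lead_coef_ev_neq0 (ev : {rmorphism {poly {poly R}} -> R}) (f : {poly {poly {poly R}}}) n :
  deg_le n f -> (map_poly ev f)`_n != 0 -> size f = n.+1 /\ ev (lead_coef f) != 0.
Proof.
rewrite coef_map /= => df nz.
have sf : size f = n.+1.
  apply/eqP; rewrite eqn_leq; apply/andP; split; first exact: df.
  rewrite ltnNge; apply: contra nz => h.
  by rewrite (nth_default _ h) rmorph0.
by split=> //; rewrite lead_coefE sf.
Qed.

(** * Specialisation at h = 0, t = 1 *)

Lemma Felim_coef4 (e c A B : R) :
  (Felim e%:P c%:P A%:P B%:P 'X 1%:P 0%:P)`_4 = 4%:R * A ^+ 7.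
Proof.
rewrite polyC0 Felim0.
have -> : A%:P ^+ 3 * (A%:P * 'X) ^+ 2 * (4%:R * (A%:P * 'X) ^+ 2 + 7%:R * (A%:P * 'X) + 2%:R)
  = (4%:R * A ^+ 7)%:P * 'X^4 + (7%:R * A ^+ 6)%:P * 'X^3 + (2%:R * A ^+ 5)%:P * 'X^2 :> {poly R}.
  rewrite !(polyC_exp, polyC_natr, polyCM); ring.
by rewrite !coefD !coefCM !coefXn /= !mulr0 mulr1 !addr0.
Qed.

Lemma Gelim_coef4 (e c A B : R) :
  (Gelim e%:P c%:P A%:P B%:P 'X 1%:P 0%:P)`_4 = 4%:R * A ^+ 8 * (e + c).
Proof.
have -> : Gelim e%:P c%:P A%:P B%:P 'X 1%:P 0%:P =
     (4%:R * A ^+ 8 * (e + c))%:P * 'X^4 + (4%:R * A ^+ 7 * (4%:R * e + c))%:P * 'X^3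
   + (A ^+ 6 * (24%:R * e + c))%:P * 'X^2
   + (16%:R * A ^+ 5 * e)%:P * 'X^1 + (4%:R * A ^+ 4 * e)%:P * 'X^0 :> {poly R}.
  rewrite polyC0 polyC1 Gelim0 /= !(polyC_exp, polyC_natr, polyCM, polyCD) expr1 expr0; ring.
by rewrite !coefD !coefCM !coefXn /= !mulr0 mulr1 !addr0.
Qed.

(* At T = 1 the quadratic form in [Gelim0], scaled by A^-4, is
   e (2 (q + 1)^2)^2 + c (2 q^2 + q)^2, so q = -1, which is no zero of [Felim0]. *)
Lemma FGelim_no_common_root (e c A B x : R) :
  0 < e -> 0 <= c -> A != 0 ->
  Felim e c A B x 1 0 = 0 -> Gelim e c A B x 1 0 = 0 -> False.
Proof.
move=> e0 c0 A0; rewrite Felim0 Gelim0 /=; move: (A * x) => q.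
move=> /eqP; rewrite !(expf_eq0, mulf_eq0) /= (negPf A0) /= => F0.
move=> /eqP; rewrite !(expf_eq0, mulf_eq0) /= (negPf A0) /= => G0.
have {G0} : e * (2%:R * (q + 1) ^+ 2) ^+ 2 + c * (2%:R * q ^+ 2 + q) ^+ 2 == 0.
  by rewrite -(eqP G0); apply/eqP; ring.
rewrite (paddr_eq0 (mulr_ge0 (ltW e0) (sqr_ge0 _)) (mulr_ge0 c0 (sqr_ge0 _))) => /andP[+ _].
rewrite mulf_eq0 (gt_eqF e0) /= expf_eq0 /= mulf_eq0 expf_eq0 /= pnatr_eq0 /=.
rewrite addr_eq0 => /eqP qE; move: F0; rewrite qE.
rewrite oppr_eq0 oner_eq0 /= sqrrN expr1n mulr1.
have -> : 4%:R + 7%:R * -1 + 2%:R = -1 :> R by ring.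
by rewrite oppr_eq0 oner_eq0.
Qed.

(** Absence of common real roots gives coprimality because F splits over the reals: its factor 4 q^2
    + 7 q + 2 has discriminant 17. Each linear factor is then tested against G. *)
Lemma coprimep_Felim_Gelim (e c A B : R) :
  0 < e -> 0 <= c -> A != 0 ->
  coprimep (Felim e%:P c%:P A%:P B%:P 'X 1%:P 0%:P)
           (Gelim e%:P c%:P A%:P B%:P 'X 1%:P 0%:P).
Proof.
move=> e0 c0 A0.
have rootF x : (Felim e%:P c%:P A%:P B%:P 'X 1%:P 0%:P).[x] = Felim e c A B x 1 0.
  by rewrite -horner_evalE rmorph_Felim /= /horner_eval !hornerC hornerX.
have rootG x : (Gelim e%:P c%:P A%:P B%:P 'X 1%:P 0%:P).[x] = Gelim e c A B x 1 0.
  by rewrite -horner_evalE rmorph_Gelim /= /horner_eval !hornerC hornerX.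
pose r : R := sqrt (IZR 17).
have r2 : r ^+ 2 = 17%:R.
  have := sqrt_sqrt (IZR 17) ltac:(lra).
  rewrite -/r expr2 => E; transitivity (Rmult r r) => //; rewrite E.
  have -> : IZR 17 = INR 17 by rewrite INR_IZR_INZ.
  by rewrite INRE.
(* The roots (-7 + sqrt 17) / 8 and (-7 - sqrt 17) / 8 in q, divided by A because q = A x. *)
pose x1 := (- 7%:R + r) / (8%:R * A); pose x2 := (- 7%:R - r) / (8%:R * A).
have FE : Felim e%:P c%:P A%:P B%:P 'X 1%:P 0%:P =
   (4%:R * A ^+ 7)%:P * (('X - 0%:P) ^+ 2 * (('X - x1%:P) * ('X - x2%:P))).
  have s12 : 4%:R * A ^+ 7 * (x1 + x2) = - (7%:R * A ^+ 6).
    by rewrite /x1 /x2; field.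
  have p12 : 4%:R * A ^+ 7 * (x1 * x2) = 2%:R * A ^+ 5.
    have -> : 4%:R * A ^+ 7 * (x1 * x2) = 4%:R * A ^+ 5 * (49%:R - r ^+ 2) / 64%:R.
      by rewrite /x1 /x2; field.
    by rewrite r2; field.
  transitivity ((4%:R * A ^+ 7)%:P * 'X^4 - (4%:R * A ^+ 7 * (x1 + x2))%:P * 'X^3
    + (4%:R * A ^+ 7 * (x1 * x2))%:P * 'X^2).
    rewrite s12 p12 polyC0 polyC1 Felim0 !(polyC_exp, polyC_natr, polyCM, polyCN); ring.
  rewrite !(polyCD, polyCM); ring.
have nroot x : Felim e c A B x 1 0 = 0 ->
    ~~ root (Gelim e%:P c%:P A%:P B%:P 'X 1%:P 0%:P) x.
  move=> Fx; apply/negP => /rootP; rewrite rootG; exact: FGelim_no_common_root Fx.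
have {}nroot x : x \in [:: 0; x1; x2] ->
   coprimep ('X - x%:P) (Gelim e%:P c%:P A%:P B%:P 'X 1%:P 0%:P).
  move=> xr; rewrite coprimep_sym coprimep_XsubC; apply: nroot; rewrite -rootF.
  apply/rootP; rewrite FE expr2 !rootM !root_XsubC.
  by move: xr; rewrite !inE => /or3P[] ->; rewrite ?orbT.
rewrite FE mul_polyC coprimepZl ?mulf_neq0 ?expf_neq0 ?pnatr_eq0 //.
by rewrite expr2 !coprimepMl !nroot // !inE eqxx ?orbT.
Qed.

Lemma no_eliminant_root_near (e c A B : R) (t t1 : R -> R) (s0 : R) :
  0 < e -> 0 <= c -> A != 0 ->
  locally s0 (fun s => is_derive t s (t1 s) /\ t1 s <> 0 /\
    exists p : R, Felim e c A B p (t s) (exp (Rmult (IZR (-2)) (t s))) = 0 /\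
                  Gelim e c A B p (t s) (exp (Rmult (IZR (-2)) (t s))) = 0) -> False.
Proof.
move=> e0 c0 A0 H.
pose C3 (a : R) : {poly {poly {poly R}}} := a%:P%:P%:P.
(* In R[t][h][p] the outermost ['X] is p, while ['X%:P] is h and ['X%:P%:P] is t. *)
pose f := Felim (C3 e) (C3 c) (C3 A) (C3 B) 'X 'X%:P%:P 'X%:P.
pose g := Gelim (C3 e) (C3 c) (C3 A) (C3 B) 'X 'X%:P%:P 'X%:P.
pose ev := horner_eval 1 \o horner_eval 0 : {rmorphism {poly {poly R}} -> R}.
have evC (a : R) : ev a%:P%:P = a by rewrite /ev /= /horner_eval !hornerC.
have evX : ev 'X = 0 by rewrite /ev /= /horner_eval hornerX hornerC.
have evT : ev 'X%:P = 1 by rewrite /ev /= /horner_eval hornerC hornerX.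
have mC a : map_poly ev (C3 a) = a%:P by rewrite map_polyC /= -[RHS](congr1 polyC (evC a)).
have mX : map_poly ev 'X = 'X by rewrite map_polyX.
have mT : map_poly ev 'X%:P%:P = 1%:P by rewrite map_polyC /= -[RHS](congr1 polyC evT).
have mH : map_poly ev 'X%:P = 0%:P by rewrite map_polyC /= -[RHS](congr1 polyC evX).
have mf : map_poly ev f = Felim e%:P c%:P A%:P B%:P 'X 1%:P 0%:P.
  transitivity (Felim (map_poly ev (C3 e)) (map_poly ev (C3 c)) (map_poly ev (C3 A))
    (map_poly ev (C3 B)) (map_poly ev 'X) (map_poly ev 'X%:P%:P) (map_poly ev 'X%:P)).
    exact: (rmorph_Felim (map_poly ev)).
  by rewrite !mC mX mT mH.
have mg : map_poly ev g = Gelim e%:P c%:P A%:P B%:P 'X 1%:P 0%:P.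
  transitivity (Gelim (map_poly ev (C3 e)) (map_poly ev (C3 c)) (map_poly ev (C3 A))
    (map_poly ev (C3 B)) (map_poly ev 'X) (map_poly ev 'X%:P%:P) (map_poly ev 'X%:P)).
    exact: (rmorph_Gelim (map_poly ev)).
  by rewrite !mC mX mT mH.
have [sf lf] : size f = 5 /\ ev (lead_coef f) != 0.
  apply: lead_coef_ev_neq0; first exact: deg_Felim.
  by rewrite mf Felim_coef4 mulf_neq0 ?expf_neq0 ?pnatr_eq0.
have [sg lg] : size g = 5 /\ ev (lead_coef g) != 0.
  apply: lead_coef_ev_neq0; first exact: deg_Gelim.
  rewrite mg Gelim_coef4 !mulf_neq0 ?expf_neq0 ?pnatr_eq0 //.
  by rewrite gt_eqF // ltr_pwDl.
apply: (no_common_root_near f g 1 t t1 s0) => //; rewrite ?sf ?sg //.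
  by rewrite -/ev mf mg coprimep_Felim_Gelim.
apply: filter_imp H => s [ds [t0 [p [Fp Gp]]]]; split=> //; split=> //.
pose h := exp (Rmult (IZR (-2)) (t s)).
pose phi := horner_eval (t s) \o horner_eval h%:P \o horner_eval p%:P%:P
  : {rmorphism {poly {poly {poly R}}} -> R}.
have phiC a : phi (C3 a) = a by rewrite /phi /= /horner_eval !hornerC.
have phiX : phi 'X = p by rewrite /phi /= /horner_eval hornerX !hornerC.
have phiT : phi 'X%:P%:P = t s by rewrite /phi /= /horner_eval !hornerC hornerX.
have phiH : phi 'X%:P = h by rewrite /phi /= /horner_eval hornerC hornerX hornerC.
exists p; split.
  rewrite -[RHS]Fp -/h -[LHS]/(phi f).
  transitivity (Felim (phi (C3 e)) (phi (C3 c)) (phi (C3 A))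
    (phi (C3 B)) (phi 'X) (phi 'X%:P%:P) (phi 'X%:P)).
    exact: (rmorph_Felim phi).
  by rewrite !phiC phiX phiT phiH.
rewrite -[RHS]Gp -/h -[LHS]/(phi g).
transitivity (Gelim (phi (C3 e)) (phi (C3 c)) (phi (C3 A))
  (phi (C3 B)) (phi 'X) (phi 'X%:P%:P) (phi 'X%:P)).
  exact: (rmorph_Gelim phi).
by rewrite !phiC phiX phiT phiH.
Qed.

Lemma FelimE (e c A B P T H : R) : Felim e c A B P T H =
  Fval ((e * T ^+ 2 + c) * H) (e * T * H) (e * H) (A + B * H) (A - B * H) P.
Proof. rewrite /Fval !RealsE /= /Felim; ring. Qed.

(** Each term of [Gval] has a factor n, m, e or n e - m^2 = e c H^2, hence a factor H. [Gelim] omits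
    one such factor, since otherwise it would vanish identically at H = 0. *)
Lemma GelimE (e c A B P T H : R) : Gelim e c A B P T H * H =
  Gval ((e * T ^+ 2 + c) * H) (e * T * H) (e * H) (A + B * H) (A - B * H) P.
Proof. rewrite /Gval !RealsE /= /Gelim; ring. Qed.

Lemma no_root_near (e c A B : R) (t t1 : R -> R) (s0 : R) :
  Rlt (IZR Z0) e -> Rle (IZR Z0) c -> A <> IZR Z0 ->
  locally s0 (fun s => is_derive t s (t1 s) /\ t1 s <> IZR Z0 /\
    exists P H : R, H = exp (Rmult (IZR (-2)) (t s)) /\
    Fval ((e * (t s) ^+ 2 + c) * H) (e * t s * H) (e * H) (A + B * H) (A - B * H) P = IZR Z0 /\
    Gval ((e * (t s) ^+ 2 + c) * H) (e * t s * H) (e * H) (A + B * H) (A - B * H) P = IZR Z0)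
  -> False.
Proof.
move=> /RltP e0 /RleP c0 /eqP A0 H; apply: (no_eliminant_root_near e c A B t t1 s0) => //.
apply: filter_imp H => s [ds [t0 [P [H [HE [FH GH]]]]]]; split=> //; split=> //.
exists P; rewrite -HE; split; first by rewrite FelimE.
move: GH; rewrite -GelimE => /eqP; rewrite mulf_eq0 => /orP[/eqP //|/eqP H0].
by have := exp_pos (Rmult (IZR (-2)) (t s)); rewrite -HE H0 => /Rlt_irrefl.
Qed.

(** Version of [poly_vanish_near] free of MathComp types: a polynomial is its list of coefficients,
    constant term first. *)
Lemma list_poly_vanish_near (l : list R) (t t1 : R -> R) (s0 : R) :
  locally s0 (fun s => is_derive t s (t1 s) /\ t1 s <> IZR Z0 /\
    List.fold_right (fun a x => Rplus a (Rmult (t s) x)) (IZR Z0) l = IZR Z0) ->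
  forall i, List.nth i l (IZR Z0) = IZR Z0.
Proof.
move=> H.
have l0 : Poly l = 0.
  apply: (poly_vanish_near _ t t1 s0); apply: filter_imp H => s [ds [t0 Hl]].
  split=> //; split=> //; rewrite -[RHS]Hl horner_Poly.
  by elim: l {Hl} => //= a l ->; rewrite addrC mulrC.
have nthE i : List.nth i l (IZR Z0) = nth 0 l i.
  by elim: l i {H l0} => [|a l IH] [|i] //=; exact: IH.
by move=> i; rewrite nthE -coef_Poly l0 coef0.
Qed.

End Elimination.

(** Homogeneity with z = e^t turns w into A + B e^(-2t) and r into P = r e^t, so that all
    exponentials become powers of h = 1 / z^2. *)
Lemma no_common_zero_near (e c A B : R) (t t1 : R -> R) (s0 : R) :
  0 < e -> 0 <= c -> A <> 0 ->
  locally s0 (fun s => is_derive t s (t1 s) /\ t1 s <> 0 /\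
    exists r, let z := exp (t s) in
    Fval (e * t s ^ 2 + c) (e * t s) e (A * z + B / z) (A * z - B / z) r = 0 /\
    Gval (e * t s ^ 2 + c) (e * t s) e (A * z + B / z) (A * z - B / z) r = 0) -> False.
Proof.
intros He Hc HA H; apply (Elimination.no_root_near e c A B t t1 s0 He Hc HA).
revert H; apply filter_imp; intros s [ds [t0 [r [HF HG]]]]; split; [exact ds | split; [exact t0 |]].
set (z := exp (t s)) in *.
assert (Hz : 0 < z) by apply exp_pos.
assert (Hz0 : z <> 0) by lra.
exists (r * z), (/ z ^ 2).
rewrite (Fval_scale _ _ _ _ _ _ _ Hz0) in HF; rewrite (Gval_scale _ _ _ _ _ _ _ Hz0) in HG.
assert (E1 : (A * z + B / z) / z = A + B * / z ^ 2) by (field; exact Hz0).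
assert (E2 : (A * z - B / z) / z = A + - (B * / z ^ 2)) by (field; exact Hz0).
rewrite E1, E2 in HF; rewrite E1, E2 in HG.
assert (Ht : t s ^ 2 = t s * t s) by ring.
unfold Rdiv in HF, HG; rewrite Ht in HF; rewrite Ht in HG.
split; [| split].
- unfold z; replace (-2 * t s) with (- (t s + t s)) by ring.
  rewrite exp_Ropp, exp_plus; f_equal; ring.
- apply Rmult_integral in HF; destruct HF as [HF | HF]; [| exact HF].
  exfalso; exact (pow_nonzero _ _ Hz0 HF).
- apply Rmult_integral in HG; destruct HG as [HG | HG]; [| exact HG].
  exfalso; exact (pow_nonzero _ _ Hz0 HG).
Qed.

(** * Calculus on an interval with possibly infinite ends *)

Lemma locally_in_interval (a b : Rbar) (s : R) :
  in_interval a b s -> locally s (in_interval a b).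
Proof.
intros H; exact (open_and _ _ (open_Rbar_gt a) (open_Rbar_lt b) s H).
Qed.

Lemma zero_derive_on_interval (a b : Rbar) (f : R -> R) :
  (forall s, in_interval a b s -> is_derive f s 0) ->
  forall s s', in_interval a b s -> in_interval a b s' -> f s = f s'.
Proof.
intros df s s' Hs Hs'.
assert (Hin : forall x, Rmin s s' <= x <= Rmax s s' -> in_interval a b x).
{ intros x [H1 H2]; destruct Hs as [Hs1 Hs2], Hs' as [Hs1' Hs2']; split.
  - destruct a as [a | |]; simpl in *; try easy.
    unfold Rmin in H1; destruct (Rle_dec s s'); lra.
  - destruct b as [b | |]; simpl in *; try easy.
    unfold Rmax in H2; destruct (Rle_dec s s'); lra. }
destruct (MVT_gen f s s' (fun _ => 0)) as [c [_ Hc]].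
- intros x Hx; apply df, Hin; lra.
- intros x Hx; apply continuity_pt_filterlim.
  apply (ex_derive_continuous (V := R_NormedModule)); exists 0; apply df, Hin, Hx.
- lra.
Qed.

Lemma is_derive_eq0_on_interval (a b : Rbar) (f : R -> R) (s l : R) :
  (forall s, in_interval a b s -> f s = 0) -> in_interval a b s ->
  is_derive f s l -> l = 0.
Proof.
intros f0 Hs df; apply (Elimination.is_derive_eq_near0 f s l df).
apply filter_imp with (2 := locally_in_interval a b s Hs); exact f0.
Qed.

(** * The reduced system *)

(* V1, V2, T, u1, v1, w1 are the derivatives of x, y, r, u, v, w with respect to t, where
   d/dt = r d/ds. *)
Section ReducedSystem.

Variables (a b : Rbar) (V1 V2 T r u v w u1 v1 w1 : R -> R).
Notation I := (in_interval a b).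
Hypothesis r_gt0 : forall s, I s -> 0 < r s.
Hypothesis dV1 : forall s, I s -> is_derive V1 s (r s * u s).
Hypothesis dV2 : forall s, I s -> is_derive V2 s (r s * v s).
Hypothesis dT : forall s, I s -> is_derive T s (r s * w s + 1).
Hypothesis dr : forall s, I s -> is_derive r s (T s / r s).
Hypothesis du : forall s, I s -> is_derive u s (u1 s / r s).
Hypothesis dv : forall s, I s -> is_derive v s (v1 s / r s).
Hypothesis dw : forall s, I s -> is_derive w s (w1 s / r s).
Hypothesis du1 : forall s, I s -> is_derive u1 s 0.
Hypothesis dv1 : forall s, I s -> is_derive v1 s 0.
Hypothesis dw1 : forall s, I s -> is_derive w1 s (w s / r s).
Hypothesis conformal : forall s, I s -> V1 s ^ 2 + V2 s ^ 2 + T s ^ 2 - r s ^ 2 = 0.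

Ltac der_fact f Hs :=
  lazymatch f with
  | V1 => constr:(dV1 _ Hs) | V2 => constr:(dV2 _ Hs) | T => constr:(dT _ Hs)
  | r => constr:(dr _ Hs) | u => constr:(du _ Hs) | v => constr:(dv _ Hs)
  | w => constr:(dw _ Hs) | u1 => constr:(du1 _ Hs) | v1 => constr:(dv1 _ Hs)
  | w1 => constr:(dw1 _ Hs)
  end.

Ltac solve_derive Hs :=
  auto_derive;
  [ repeat split;
    lazymatch goal with
    | |- ex_derive (fun x => ?f x) _ => let H := der_fact f Hs in exact (ex_intro _ _ H)
    | |- _ => idtac
    end
  | repeat match goal with
    | |- context [Derive (fun x => ?f x) ?s] =>
        let H := der_fact f Hs in
        change (Derive (fun x => f x) s) with (Derive f s);
        rewrite (is_derive_unique f s _ H)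
    end ].

(* Each of the next four equations is the derivative d/dt of the previous one, starting from
   [conformal]. *)
Lemma normal_eq s : I s -> u s * V1 s + v s * V2 s + w s * T s = 0.
Proof.
intros Hs; assert (Hr := r_gt0 s Hs).
(* In d/ds of [conformal] the summand 1 of T' cancels against the derivative of r^2, which leaves 2
   r times the claim. *)
apply (Rmult_eq_reg_l (2 * r s)); [| lra]; rewrite Rmult_0_r.
apply (is_derive_eq0_on_interval a b _ s _ conformal Hs).
solve_derive Hs; field; lra.
Qed.

Lemma normal_eq1 s : I s ->
  u1 s * V1 s + v1 s * V2 s + w1 s * T s
    + r s ^ 2 * (u s ^ 2 + v s ^ 2 + w s ^ 2) + w s * r s = 0.
Proof.
intros Hs; assert (Hr := r_gt0 s Hs).
apply (Rmult_eq_reg_l (/ r s)); [| apply Rinv_neq_0_compat; lra]; rewrite Rmult_0_r.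
apply (is_derive_eq0_on_interval a b _ s _ normal_eq Hs).
solve_derive Hs; field; lra.
Qed.

Lemma normal_eq2 s : I s ->
  2 * T s * (r s * (w s ^ 2 + (u s ^ 2 + v s ^ 2)) + w s)
  + r s * (3 * (w s * w1 s + (u s * u1 s + v s * v1 s)) * r s + 2 * w1 s) = 0.
Proof.
intros Hs; assert (Hr := r_gt0 s Hs).
apply (Rmult_eq_reg_l (/ r s)); [| apply Rinv_neq_0_compat; lra]; rewrite Rmult_0_r.
apply (is_derive_eq0_on_interval a b _ s _ normal_eq1 Hs).
solve_derive Hs; field; lra.
Qed.

Lemma normal_eq3 s : I s ->
  2 * (w s ^ 2 + (u s ^ 2 + v s ^ 2)) * T s ^ 2
  + T s * (10 * (w s * w1 s + (u s * u1 s + v s * v1 s)) * r s + 4 * w1 s)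
  + 2 * w s * (w s ^ 2 + (u s ^ 2 + v s ^ 2)) * r s ^ 3
  + (2 * (w s ^ 2 + (u s ^ 2 + v s ^ 2)) + 2 * w s ^ 2
     + 3 * (u1 s ^ 2 + v1 s ^ 2 + w1 s ^ 2 + w s ^ 2)) * r s ^ 2
  + 4 * w s * r s = 0.
Proof.
intros Hs; assert (Hr := r_gt0 s Hs).
apply (Rmult_eq_reg_l (/ r s)); [| apply Rinv_neq_0_compat; lra]; rewrite Rmult_0_r.
apply (is_derive_eq0_on_interval a b _ s _ normal_eq2 Hs).
solve_derive Hs; field; lra.
Qed.

(** [normal_eq2] reads 2 K T = - r sg and [normal_eq3] is quadratic in T. Pseudo-division of 2 K^2
    times the latter by the former eliminates T without dividing by K; the remainder is r F. *)
Lemma Fval_eq0 s : I s ->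
  Fval (u s ^ 2 + v s ^ 2) (u s * u1 s + v s * v1 s) (u1 s ^ 2 + v1 s ^ 2)
    (w s) (w1 s) (r s) = 0.
Proof.
intros Hs; assert (Hr := r_gt0 s Hs).
assert (E4 := normal_eq2 s Hs); assert (E5 := normal_eq3 s Hs).
apply (Rmult_eq_reg_l (r s)); [| lra]; rewrite Rmult_0_r; unfold Fval.
set (n := u s ^ 2 + v s ^ 2) in *; set (m := u s * u1 s + v s * v1 s) in *.
set (e := u1 s ^ 2 + v1 s ^ 2) in *.
revert E4 E5; generalize (w s) (w1 s) (r s) (T s) n m e.
clear; intros w w1 r T n m e E4 E5.
match type of E4 with ?X = _ => match type of E5 with ?Y = _ =>
  transitivity (2 * (r * (w ^ 2 + n) + w) ^ 2 * Y
    - ((w ^ 2 + n) * (2 * (r * (w ^ 2 + n) + w) * T - r * (3 * (w * w1 + m) * r + 2 * w1))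
       + (r * (w ^ 2 + n) + w) * (10 * (w * w1 + m) * r + 4 * w1)) * X) end end.
- ring.
- rewrite E4, E5; ring.
Qed.

(** The plane vectors V = (V1, V2), U and U_t have zero Gram determinant: (n e - m^2) |V|^2 = q^2 n
    - 2 p q m + p^2 e, with p = U . V and q = U_t . V. The previous equations express 2 K p, 2 K q
    and 2 K T without V, and |V|^2 = r^2 - T^2. *)
Lemma Gval_eq0 s : I s ->
  Gval (u s ^ 2 + v s ^ 2) (u s * u1 s + v s * v1 s) (u1 s ^ 2 + v1 s ^ 2)
    (w s) (w1 s) (r s) = 0.
Proof.
intros Hs; assert (Hr := r_gt0 s Hs).
assert (E1 := conformal s Hs); assert (E2 := normal_eq s Hs).
assert (E3 := normal_eq1 s Hs); assert (E4 := normal_eq2 s Hs).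
apply (Rmult_eq_reg_l (r s ^ 2)); [| apply pow_nonzero; lra]; rewrite Rmult_0_r; unfold Gval.
revert E1 E2 E3 E4; generalize (w s) (w1 s) (r s) (T s) (V1 s) (V2 s) (u s) (u1 s) (v s) (v1 s).
clear; intros w w1 r T V1 V2 u u1 v v1 E1 E2 E3 E4.
set (n := u ^ 2 + v ^ 2) in *; set (m := u * u1 + v * v1) in *.
set (N := w ^ 2 + n) in *.
set (K := N * r + w); set (sg := 3 * (w * w1 + m) * r + 2 * w1) in *.
set (p := u * V1 + v * V2); set (q := u1 * V1 + v1 * V2).
assert (Hsg : r * sg = - (2 * T * K)) by (unfold K; lra).
assert (Hp : r * w * sg = 2 * K * p).
{ replace (r * w * sg) with (w * (r * sg)) by ring; rewrite Hsg.
  replace p with (- (w * T)) by (unfold p; lra); ring. }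
assert (Hq : r * (2 * K ^ 2 - w1 * sg) = - (2 * K * q)).
{ replace (r * (2 * K ^ 2 - w1 * sg)) with (2 * r * K ^ 2 - w1 * (r * sg)) by ring; rewrite Hsg.
  replace q with (- (w1 * T + r * K)); [ring |].
  clear -E3; unfold q, K, N, n in *; lra. }
transitivity ((r * (2 * K ^ 2 - w1 * sg)) ^ 2 * n
  + 2 * (r * w * sg) * (r * (2 * K ^ 2 - w1 * sg)) * m + (r * w * sg) ^ 2 * (u1 ^ 2 + v1 ^ 2)
  - (n * (u1 ^ 2 + v1 ^ 2) - m ^ 2) * (4 * K ^ 2 * r ^ 2 - (r * sg) ^ 2)); [ring |].
rewrite Hp, Hq, Hsg.
replace (r ^ 2) with (V1 ^ 2 + V2 ^ 2 + T ^ 2) by lra.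
unfold p, q, n, m; ring.
Qed.

(** * The case of constant (u, v) *)

Lemma constant_square_norm : (forall s, I s -> u1 s = 0 /\ v1 s = 0) ->
  forall s s', I s -> I s' -> u s ^ 2 + v s ^ 2 = u s' ^ 2 + v s' ^ 2.
Proof.
intros H; apply (zero_derive_on_interval a b (fun s => u s ^ 2 + v s ^ 2)); intros s Hs.
assert (Hr := r_gt0 s Hs); destruct (H s Hs) as [Hu Hv].
solve_derive Hs; rewrite Hu, Hv; field; lra.
Qed.

Lemma constant_w_invariant s s' : I s -> I s' ->
  w s ^ 2 - w1 s ^ 2 = w s' ^ 2 - w1 s' ^ 2.
Proof.
apply (zero_derive_on_interval a b (fun s => w s ^ 2 - w1 s ^ 2)); clear s s'; intros s Hs.
assert (Hr := r_gt0 s Hs); solve_derive Hs; field; lra.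
Qed.

(* Here r satisfies a quadratic equation over R[w]; its derivative is a multiple of w1^2 times
   an equation that is linear in r, and eliminating r leaves the sextic in w of the proof. *)
Lemma w1_eq0_of_constant s0 : (forall s, I s -> u1 s = 0 /\ v1 s = 0) -> I s0 -> w1 s0 = 0.
Proof.
intros H0 Hs0; destruct (Req_dec (w1 s0) 0) as [| Hw1]; [assumption | exfalso].
set (n := u s0 ^ 2 + v s0 ^ 2); set (k := w s0 ^ 2 - w1 s0 ^ 2).
assert (Hn : forall s, I s -> u s ^ 2 + v s ^ 2 = n)
  by (intros s Hs; apply constant_square_norm; assumption).
assert (Hk : forall s, I s -> w1 s ^ 2 = w s ^ 2 - k)
  by (intros s Hs; assert (E := constant_w_invariant s s0 Hs Hs0); unfold k; lra).
(* With u1 = v1 = 0 the V terms of [normal_eq1] disappear, which leaves w1 T in terms of r and w. *)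
assert (HT : forall s, I s -> w1 s * T s = - (r s * (r s * (w s ^ 2 + n) + w s))).
{ intros s Hs; assert (E := normal_eq1 s Hs); destruct (H0 s Hs) as [Hu Hv].
  rewrite Hu, Hv in E; rewrite <- (Hn s Hs); lra. }
assert (HQ : forall s, I s -> 2 * (w s ^ 2 + n) ^ 2 * r s ^ 2
    + w s * (w s ^ 2 + 4 * n + 3 * k) * r s + 2 * k = 0).
{ intros s Hs; assert (Hr := r_gt0 s Hs); destruct (H0 s Hs) as [Hu Hv].
  assert (E := normal_eq2 s Hs); rewrite Hu, Hv, (Hn s Hs) in E.
  assert (E' : 2 * (w1 s * T s) * (r s * (w s ^ 2 + n) + w s)
      + r s * (3 * w s * r s + 2) * w1 s ^ 2 = 0)
    by (transitivity (w1 s * 0); [rewrite <- E |]; ring).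
  rewrite (HT s Hs), (Hk s Hs) in E'.
  apply (Rmult_eq_reg_l (- r s)); [| lra]; rewrite Rmult_0_r, <- E'; ring. }
assert (HL : forall s, I s ->
    w1 s ^ 2 * ((2 * w s ^ 2 + 3 * k) + 5 * w s * (w s ^ 2 + n) * r s) = 0).
{ intros s Hs; assert (Hr := r_gt0 s Hs).
  assert (E : (8 * (w s ^ 2 + n) * w s * w1 s * r s ^ 2 + 4 * (w s ^ 2 + n) ^ 2 * r s * T s
      + (3 * w s ^ 2 + 4 * n + 3 * k) * w1 s * r s
      + w s * (w s ^ 2 + 4 * n + 3 * k) * T s) / r s = 0).
  { apply (is_derive_eq0_on_interval a b _ s _ HQ Hs); solve_derive Hs; field; lra. }
  assert (E' : 8 * (w s ^ 2 + n) * w s * w1 s ^ 2 * r s ^ 2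
      + 4 * (w s ^ 2 + n) ^ 2 * r s * (w1 s * T s)
      + (3 * w s ^ 2 + 4 * n + 3 * k) * w1 s ^ 2 * r s
      + w s * (w s ^ 2 + 4 * n + 3 * k) * (w1 s * T s) = 0).
  { transitivity (w1 s * r s * 0); [rewrite <- E; field; lra | ring]. }
  rewrite (HT s Hs) in E'; rewrite (Hk s Hs) in E' |- *.
  assert (Q := HQ s Hs); apply (Rmult_eq_reg_l (r s)); [| lra]; rewrite Rmult_0_r.
  (* This multiple of [HQ] cancels the cubic term in r; what remains is divisible by r w1^2. *)
  match type of E' with ?X = _ => match type of Q with ?Y = _ =>
    transitivity (X + 2 * (w s ^ 2 + n) * r s * Y) end end.
  - ring.
  - rewrite E', Q; ring. }
(* The sextic is 25 w^2 (w^2 + n) times [HQ], with r removed through [HL]. Its leading coefficient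
   -2 is independent of n and k, so it cannot vanish identically. *)
assert (E : nth 6 (18 * k ^ 2 * n :: 0 :: 14 * k * n - 27 * k ^ 2 :: 0
    :: 29 * k - 32 * n :: 0 :: - 2 :: nil) 0 = 0).
{ apply (Elimination.list_poly_vanish_near _ w (fun s => w1 s / r s) s0).
  (* Near [s0] the derivative of w stays nonzero, so w itself can serve as the parameter. *)
  assert (Hw1' : locally s0 (fun s => w1 s <> 0)).
  { assert (C : continuous w1 s0)
      by (apply (ex_derive_continuous (V := R_NormedModule)); eexists; apply dw1, Hs0).
    apply (C (fun y => y <> 0)); apply (open_neq 0 _ Hw1). }
  generalize (filter_and _ _ (locally_in_interval a b s0 Hs0) Hw1').
  apply filter_imp; intros s [Hs Hw]; assert (Hr := r_gt0 s Hs).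
  split; [apply dw, Hs | split].
  - apply Rmult_integral_contrapositive_currified; [exact Hw | apply Rinv_neq_0_compat; lra].
  - assert (Q := HQ s Hs); assert (L := HL s Hs).
    apply Rmult_integral in L; destruct L as [L | L];
      [exfalso; exact (pow_nonzero _ _ Hw L) |].
    assert (L' : 5 * w s * (w s ^ 2 + n) * r s = - (2 * w s ^ 2 + 3 * k)) by lra.
    simpl.
    transitivity (2 * (w s ^ 2 + n) * (5 * w s * (w s ^ 2 + n) * r s) ^ 2
      + 5 * w s ^ 2 * (w s ^ 2 + 4 * n + 3 * k) * (5 * w s * (w s ^ 2 + n) * r s)
      + 50 * k * w s ^ 2 * (w s ^ 2 + n)).
    + rewrite L'; ring.
    + transitivity (25 * w s ^ 2 * (w s ^ 2 + n) * 0); [rewrite <- Q |]; ring. }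
simpl in E; lra.
Qed.

(** Once w1 vanishes identically, so does its t-derivative w, and [normal_eq1] reduces to r^2 (u^2 +
    v^2) = 0. *)
Lemma flat_of_constant : (forall s, I s -> u1 s = 0 /\ v1 s = 0) ->
  forall s, I s -> u s = 0 /\ v s = 0 /\ w s = 0.
Proof.
intros H0 s Hs; assert (Hr := r_gt0 s Hs).
assert (Hw1 : forall s, I s -> w1 s = 0) by (intros; apply w1_eq0_of_constant; assumption).
assert (Hw : w s = 0).
{ assert (E := is_derive_eq0_on_interval a b _ s _ Hw1 Hs (dw1 s Hs)).
  apply (Rmult_eq_reg_r (/ r s)); [| apply Rinv_neq_0_compat; lra].
  rewrite Rmult_0_l; exact E. }
assert (E := normal_eq1 s Hs); destruct (H0 s Hs) as [Hu1 Hv1].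
rewrite Hu1, Hv1, Hw, (Hw1 s Hs) in E.
assert (E' : u s ^ 2 + v s ^ 2 = 0).
{ apply (Rmult_eq_reg_l (r s ^ 2)); [| apply pow_nonzero; lra].
  rewrite Rmult_0_r, <- E; ring. }
split; [| split; [| exact Hw]]; nra.
Qed.

(** * The case of nonconstant (u, v) *)

Section NonConstant.

Variable s0 : R.
Hypothesis Hs0 : I s0.
Let e := u1 s0 ^ 2 + v1 s0 ^ 2.
(** The conformal parameter, normalised by U . U_t = e t. The constant [c] is the squared distance
    from the origin to the line that carries U. *)
Let t s := (u s * u1 s0 + v s * v1 s0) / e.
Let c := (u s0 * v1 s0 - v s0 * u1 s0) ^ 2 / e.
Hypothesis e_gt0 : 0 < e.

Lemma u1_const s : I s -> u1 s = u1 s0.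
Proof. intros Hs; exact (zero_derive_on_interval a b u1 du1 s s0 Hs Hs0). Qed.

Lemma v1_const s : I s -> v1 s = v1 s0.
Proof. intros Hs; exact (zero_derive_on_interval a b v1 dv1 s s0 Hs Hs0). Qed.

Lemma is_derive_t s : I s -> is_derive t s (/ r s).
Proof.
intros Hs; assert (Hr := r_gt0 s Hs); unfold t; solve_derive Hs.
rewrite (u1_const s Hs), (v1_const s Hs); unfold e in *; field; lra.
Qed.

Lemma inner_eq s : I s -> u s * u1 s + v s * v1 s = e * t s.
Proof.
intros Hs; rewrite (u1_const s Hs), (v1_const s Hs); unfold t; field; lra.
Qed.

(** Lagrange's identity |U|^2 |U_t|^2 = (U . U_t)^2 + det(U, U_t)^2, where the determinant is
    constant because U_t is. *)
Lemma square_norm_eq s : I s -> u s ^ 2 + v s ^ 2 = e * t s ^ 2 + c.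
Proof.
intros Hs.
assert (E : u s * v1 s0 - v s * u1 s0 = u s0 * v1 s0 - v s0 * u1 s0).
{ apply (zero_derive_on_interval a b (fun s => u s * v1 s0 - v s * u1 s0)); try assumption.
  clear s Hs; intros s Hs; assert (Hr := r_gt0 s Hs); solve_derive Hs.
  rewrite (u1_const s Hs), (v1_const s Hs); field; lra. }
unfold c, t; rewrite <- E; unfold e in *; field; lra.
Qed.

Lemma c_ge0 : 0 <= c.
Proof.
unfold c; apply Rmult_le_pos; [apply pow2_ge_0 | apply Rlt_le, Rinv_0_lt_compat, e_gt0].
Qed.

Let A := (w s0 + w1 s0) / (2 * exp (t s0)).
Let B := (w s0 - w1 s0) * exp (t s0) / 2.

(** From w_t = w1 and w1_t = w, the products (w + w1) e^(-t) and (w - w1) e^t are constant. *)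
Lemma w_exp s : I s -> w s = A * exp (t s) + B / exp (t s) /\
  w1 s = A * exp (t s) - B / exp (t s).
Proof.
intros Hs.
assert (EA : (w s + w1 s) * exp (- t s) = (w s0 + w1 s0) * exp (- t s0)).
{ apply (zero_derive_on_interval a b (fun s => (w s + w1 s) * exp (- t s))); try assumption.
  clear s Hs; intros s Hs; assert (Hr := r_gt0 s Hs).
  auto_derive.
  - repeat split; [eexists; apply dw, Hs | eexists; apply dw1, Hs | eexists; apply is_derive_t, Hs].
  - change (Derive (fun x => w x) s) with (Derive w s).
    change (Derive (fun x => w1 x) s) with (Derive w1 s).
    change (Derive (fun x => t x) s) with (Derive t s).
    rewrite (is_derive_unique _ _ _ (dw s Hs)), (is_derive_unique _ _ _ (dw1 s Hs)),
      (is_derive_unique _ _ _ (is_derive_t s Hs)); field; lra. }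
assert (EB : (w s - w1 s) * exp (t s) = (w s0 - w1 s0) * exp (t s0)).
{ apply (zero_derive_on_interval a b (fun s => (w s - w1 s) * exp (t s))); try assumption.
  clear s Hs EA; intros s Hs; assert (Hr := r_gt0 s Hs).
  auto_derive.
  - repeat split; [eexists; apply dw, Hs | eexists; apply dw1, Hs | eexists; apply is_derive_t, Hs].
  - change (Derive (fun x => w x) s) with (Derive w s).
    change (Derive (fun x => w1 x) s) with (Derive w1 s).
    change (Derive (fun x => t x) s) with (Derive t s).
    rewrite (is_derive_unique _ _ _ (dw s Hs)), (is_derive_unique _ _ _ (dw1 s Hs)),
      (is_derive_unique _ _ _ (is_derive_t s Hs)); field; lra. }
assert (P := exp_pos (t s)); assert (P0 := exp_pos (t s0)).
rewrite !exp_Ropp in EA.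
assert (HA : A * exp (t s) = (w s + w1 s) / 2).
{ unfold A; transitivity ((w s0 + w1 s0) * / exp (t s0) * exp (t s) / 2); [field; lra |].
  rewrite <- EA; field; lra. }
assert (HB : B / exp (t s) = (w s - w1 s) / 2).
{ unfold B; rewrite <- EB; field; lra. }
rewrite HA, HB; lra.
Qed.

Lemma r_inv_neq0 s : I s -> / r s <> 0.
Proof. intros Hs; assert (Hr := r_gt0 s Hs); apply Rinv_neq_0_compat; lra. Qed.

Lemma A_eq0 : A = 0.
Proof.
destruct (Req_dec A 0) as [| HA]; [assumption | exfalso].
apply (no_common_zero_near e c A B t (fun s => / r s) s0 e_gt0 c_ge0 HA).
generalize (locally_in_interval a b s0 Hs0); apply filter_imp; intros s Hs.
split; [apply is_derive_t, Hs | split; [apply r_inv_neq0, Hs | exists (r s)]].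
cbv zeta; destruct (w_exp s Hs) as [<- <-].
rewrite <- (square_norm_eq s Hs), <- (inner_eq s Hs).
assert (F := Fval_eq0 s Hs); assert (G := Gval_eq0 s Hs).
rewrite (u1_const s Hs), (v1_const s Hs) in F, G |- *; split; assumption.
Qed.

(** Reversing t exchanges A and B and negates w1 and m. Then M and sg change sign too, and every
    term of F and G is even in these quantities jointly. *)
Lemma B_eq0 : B = 0.
Proof.
destruct (Req_dec B 0) as [| HB]; [assumption | exfalso].
apply (no_common_zero_near e c B A (fun s => - t s) (fun s => - / r s) s0 e_gt0 c_ge0 HB).
generalize (locally_in_interval a b s0 Hs0); apply filter_imp; intros s Hs.
split; [apply (is_derive_opp (V := R_NormedModule)), is_derive_t, Hs | split].
{ apply Ropp_neq_0_compat, r_inv_neq0, Hs. }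
exists (r s); cbv zeta; destruct (w_exp s Hs) as [Ew Ew1].
assert (P := exp_pos (t s)); rewrite exp_Ropp.
replace (B * / exp (t s) + A / / exp (t s)) with (w s) by (rewrite Ew; field; lra).
replace (B * / exp (t s) - A / / exp (t s)) with (- w1 s) by (rewrite Ew1; field; lra).
replace (e * (- t s) ^ 2 + c) with (e * t s ^ 2 + c) by ring.
replace (e * - t s) with (- (e * t s)) by ring.
rewrite <- (square_norm_eq s Hs), <- (inner_eq s Hs).
assert (F := Fval_eq0 s Hs); assert (G := Gval_eq0 s Hs).
rewrite (u1_const s Hs), (v1_const s Hs) in F, G |- *.
split; [rewrite <- F; unfold Fval | rewrite <- G; unfold Gval]; unfold e; ring.
Qed.

(** With w = w1 = 0, [normal_eq2] becomes 2 n T = -3 m r, which eliminates T from [normal_eq3]. *)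
Lemma nonconstant_absurd : False.
Proof.
assert (Hw : forall s, I s -> w s = 0 /\ w1 s = 0).
{ intros s Hs; destruct (w_exp s Hs) as [-> ->]; rewrite A_eq0, B_eq0; split; unfold Rdiv; ring. }
(* Coefficients in t of 4 n^2 + 6 e n - 21 m^2 for n = e t^2 + c and m = e t; the leading one, 4
   e^2, is positive. *)
assert (E : nth 4 (4 * c ^ 2 + 6 * e * c :: 0 :: 8 * e * c - 15 * e ^ 2 :: 0
    :: 4 * e ^ 2 :: nil) 0 = 0).
{ apply (Elimination.list_poly_vanish_near _ t (fun s => / r s) s0).
  generalize (locally_in_interval a b s0 Hs0); apply filter_imp; intros s Hs.
  split; [apply is_derive_t, Hs | split; [apply r_inv_neq0, Hs |]].
  assert (Hr := r_gt0 s Hs); destruct (Hw s Hs) as [Ew Ew1].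
  assert (E4 := normal_eq2 s Hs); assert (E5 := normal_eq3 s Hs).
  rewrite Ew, Ew1, (inner_eq s Hs), (square_norm_eq s Hs) in E4, E5.
  rewrite (u1_const s Hs), (v1_const s Hs) in E5; fold e in E5.
  simpl; set (n := e * t s ^ 2 + c) in *; set (m := e * t s) in *.
  assert (E4' : 2 * n * T s = - 3 * m * r s).
  { apply (Rmult_eq_reg_l (r s)); [| lra]. ring_simplify in E4; ring_simplify; lra. }
  assert (E5' : (2 * n * T s) ^ 2 + 10 * m * r s * (2 * n * T s)
      + (2 * n + 3 * e) * (2 * n) * r s ^ 2 = 0).
  { transitivity (2 * n * 0); [rewrite <- E5 |]; ring. }
  rewrite E4' in E5'.
  apply (Rmult_eq_reg_l (r s ^ 2)); [| apply pow_nonzero; lra].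
  match type of E5' with ?X = _ => transitivity X end; [unfold n, m; ring | rewrite E5'; ring]. }
simpl in E; assert (0 < e ^ 2) by (apply pow_lt, e_gt0); simpl in *; lra.
Qed.

End NonConstant.

Lemma reduced_system_flat s : I s -> u s = 0 /\ v s = 0 /\ w s = 0.
Proof.
apply flat_of_constant; clear s; intros s Hs.
destruct (Req_dec (u1 s ^ 2 + v1 s ^ 2) 0) as [E | E].
- split; nra.
- exfalso; apply (nonconstant_absurd s Hs); nra.
Qed.

End ReducedSystem.

(** * Separation of variables *)

Definition radial_lapl (r f : R -> R) (s : R) : R :=
  / r s * Derive (fun t => r t * Derive f t) s.

(** [Derive] is total and commutes with constant factors for every function, so the identity is
    purely algebraic. *)
Lemma lapl_separated (r f c : R -> R) (s th : R) :
  lapl r (fun s th => f s * c th) s th =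
  radial_lapl r f s * c th + / (r s ^ 2) * (f s * Derive (Derive c) th).
Proof.
unfold lapl, dS, dT, radial_lapl.
assert (E : forall t, Derive (fun s => f s * c th) t = Derive f t * c th)
  by (intros t; apply Derive_scal_l).
rewrite (Derive_ext (fun t => r t * Derive (fun s => f s * c th) t)
  (fun t => (r t * Derive f t) * c th)) by (intros t; rewrite E; ring).
rewrite Derive_scal_l.
rewrite (Derive_ext (fun t => Derive (fun t' => f s * c t') t) (fun t => f s * Derive c t))
  by (intros t; apply Derive_scal).
rewrite Derive_scal; ring.
Qed.

Lemma radial_lapl_scal (r f : R -> R) (k s : R) :
  radial_lapl r (fun s => k * f s) s = k * radial_lapl r f s.
Proof.
unfold radial_lapl.
rewrite (Derive_ext _ (fun t => k * (r t * Derive f t)))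
  by (intros t; rewrite Derive_scal; ring).
rewrite Derive_scal; ring.
Qed.

Lemma Derive_Derive_cos th : Derive (Derive cos) th = - cos th.
Proof.
rewrite (Derive_ext (Derive cos) (fun t => - sin t))
  by (intros t; apply is_derive_unique, is_derive_cos).
apply is_derive_unique; auto_derive; [trivial | ring].
Qed.

Lemma Derive_Derive_sin th : Derive (Derive sin) th = - sin th.
Proof.
rewrite (Derive_ext (Derive sin) cos)
  by (intros t; apply is_derive_unique, is_derive_sin).
apply is_derive_unique, is_derive_cos.
Qed.

Lemma Derive_Derive_const k th : Derive (Derive (fun _ => k)) th = 0.
Proof.
rewrite (Derive_ext (Derive (fun _ => k)) (fun _ => 0)) by (intros t; apply Derive_const).
apply Derive_const.
Qed.

(** The common factor of cos and sin in 2H, which is w of the reduced system. The last term keeps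
    the shape produced by the second angular derivative and equals 1 / r where r > 0. *)
Definition normal_radial (r : R -> R) (s : R) : R :=
  radial_lapl r r s - / (r s ^ 2) * r s.

Definition angular (i : nat) (th : R) : R :=
  match i with O | 1%nat => 1 | 2%nat => cos th | _ => sin th end.

Definition profile (x y r : R -> R) (i : nat) : R -> R :=
  match i with O => x | 1%nat => y | _ => r end.

Definition curvature_profile (x y r : R -> R) (i : nat) : R -> R :=
  match i with
  | O => radial_lapl r x | 1%nat => radial_lapl r y | _ => normal_radial r
  end.

(** An equality of functions, so that it can be rewritten inside [lapl], which differentiates
    them. *)
Lemma Hc_separated (x y r : R -> R) (i : nat) : (i < 4)%nat ->
  Hc x y r i = fun s th => (/ 2 * curvature_profile x y r i s) * angular i th.
Proof.
intros Hi; apply functional_extensionality; intros s; apply functional_extensionality; intros th.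
assert (EX : Xc x y r i = fun s th => profile x y r i s * angular i th).
{ apply functional_extensionality; intros s'; apply functional_extensionality; intros th'.
  destruct i as [| [| [|]]]; simpl; ring. }
unfold Hc; rewrite EX, lapl_separated.
destruct i as [| [| [| i]]]; simpl profile; simpl curvature_profile; unfold angular.
- rewrite Derive_Derive_const; ring.
- rewrite Derive_Derive_const; ring.
- rewrite Derive_Derive_cos; unfold normal_radial; ring.
- rewrite Derive_Derive_sin; unfold normal_radial; ring.
Qed.

Lemma smooth_on_derive (a b : Rbar) (f : R -> R) (n : nat) (s : R) :
  smooth_on a b f -> in_interval a b s ->
  is_derive (Derive_n f n) s (Derive_n f (S n) s).
Proof. intros Hf Hs; apply Derive_correct; exact (Hf (S n) s Hs). Qed.

Lemma ex_derive_eq_on_interval (a b : Rbar) (f g : R -> R) (s : R) :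
  (forall s, in_interval a b s -> f s = g s) -> in_interval a b s ->
  ex_derive g s -> ex_derive f s.
Proof.
intros E Hs; apply ex_derive_ext_loc.
generalize (locally_in_interval a b s Hs); apply filter_imp; intros t Ht; symmetry; apply E, Ht.
Qed.

(** * Differentiability of the radial Laplacian *)

Section RadialRegularity.
Variables (a b : Rbar) (r f : R -> R).
Hypotheses (Sr : smooth_on a b r) (Sf : smooth_on a b f).
Hypothesis r_gt0 : forall s, in_interval a b s -> 0 < r s.

Let r1 := Derive_n r 1.
Let r2 := Derive_n r 2.
Let f1 := Derive_n f 1.
Let f2 := Derive_n f 2.
Let f3 := Derive_n f 3.

Lemma is_derive_radial s : in_interval a b s ->
  is_derive (fun t => r t * Derive f t) s (r1 s * f1 s + r s * f2 s).
Proof.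
intros Hs; apply (is_derive_mult r (Derive f) s (r1 s) (f2 s)).
- exact (smooth_on_derive a b r 0 s Sr Hs).
- exact (smooth_on_derive a b f 1 s Sf Hs).
- intros; apply Rmult_comm.
Qed.

Lemma radial_lapl_eq s : in_interval a b s ->
  radial_lapl r f s = / r s * (r1 s * f1 s + r s * f2 s).
Proof.
intros Hs; unfold radial_lapl; f_equal; apply is_derive_unique, is_derive_radial, Hs.
Qed.

Lemma is_derive_radial_lapl s : in_interval a b s ->
  is_derive (radial_lapl r f) s
    (- r1 s / r s ^ 2 * (r1 s * f1 s + r s * f2 s)
     + / r s * (r2 s * f1 s + 2 * r1 s * f2 s + r s * f3 s)).
Proof.
intros Hs; assert (Hr := r_gt0 s Hs).
apply (is_derive_ext_loc (fun s => / r s * (r1 s * f1 s + r s * f2 s))).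
{ generalize (locally_in_interval a b s Hs); apply filter_imp.
  intros t Ht; symmetry; apply radial_lapl_eq, Ht. }
assert (Dr : is_derive r s (r1 s)) by exact (smooth_on_derive a b r 0 s Sr Hs).
assert (Dr1 : is_derive r1 s (r2 s)) by exact (smooth_on_derive a b r 1 s Sr Hs).
assert (Df1 : is_derive f1 s (f2 s)) by exact (smooth_on_derive a b f 1 s Sf Hs).
assert (Df2 : is_derive f2 s (f3 s)) by exact (smooth_on_derive a b f 2 s Sf Hs).
clearbody r1 r2 f1 f2 f3.
auto_derive.
- repeat split; try (eexists; eassumption); lra.
- change (Derive (fun x => r x) s) with (Derive r s).
  change (Derive (fun x => r1 x) s) with (Derive r1 s).
  change (Derive (fun x => f1 x) s) with (Derive f1 s).
  change (Derive (fun x => f2 x) s) with (Derive f2 s).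
  rewrite (is_derive_unique _ _ _ Dr), (is_derive_unique _ _ _ Dr1),
    (is_derive_unique _ _ _ Df1), (is_derive_unique _ _ _ Df2); field; lra.
Qed.

(** [Derive] has a value even where no derivative exists; this existence turns the biharmonic
    equation into an [is_derive] fact. *)
Lemma ex_derive_radial_derive s : in_interval a b s ->
  ex_derive (fun t => r t * Derive (radial_lapl r f) t) s.
Proof.
intros Hs; assert (Hr := r_gt0 s Hs).
apply (ex_derive_eq_on_interval a b _ (fun s => r s *
  (- r1 s / r s ^ 2 * (r1 s * f1 s + r s * f2 s)
     + / r s * (r2 s * f1 s + 2 * r1 s * f2 s + r s * f3 s)))); [| exact Hs |].
{ intros t Ht; f_equal; apply is_derive_unique, is_derive_radial_lapl, Ht. }
assert (Dr := smooth_on_derive a b r 0 s Sr Hs).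
assert (Dr1 := smooth_on_derive a b r 1 s Sr Hs).
assert (Dr2 := smooth_on_derive a b r 2 s Sr Hs).
assert (Df1 := smooth_on_derive a b f 1 s Sf Hs).
assert (Df2 := smooth_on_derive a b f 2 s Sf Hs).
assert (Df3 := smooth_on_derive a b f 3 s Sf Hs).
fold r1 in Dr1; fold r2 in Dr2; fold f1 in Df1; fold f2 in Df2; fold f3 in Df3.
change (Derive_n r 0) with r in Dr.
revert Dr Dr1 Dr2 Df1 Df2 Df3; generalize (Derive_n r 1 s) (Derive_n r 2 s) (Derive_n r 3 s)
  (Derive_n f 2 s) (Derive_n f 3 s) (Derive_n f 4 s).
clearbody r1 r2 f1 f2 f3; intros.
auto_derive; repeat split; try (eexists; eassumption); try lra.
apply Rgt_not_eq; nra.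
Qed.

End RadialRegularity.

(** * From the biharmonic equation to the reduced system *)

Theorem theorem1p1 (a b : Rbar) (x y r : R -> R) :
  Rbar_lt a b ->
  smooth_on a b x -> smooth_on a b y -> smooth_on a b r ->
  (forall s, in_interval a b s -> 0 < r s) ->
  (forall s, in_interval a b s ->
     (Derive x s) ^ 2 + (Derive y s) ^ 2 + (Derive r s) ^ 2 = 1) ->
  (* biharmonic: Delta H = 0 componentwise on I x R *)
  (forall (i : nat) (s th : R), (i < 4)%nat -> in_interval a b s ->
     lapl r (Hc x y r i) s th = 0) ->
  (* minimal: H = 0 on I x R *)
  forall (i : nat) (s th : R), (i < 4)%nat -> in_interval a b s ->
    Hc x y r i s th = 0.
Proof.
intros _ Sx Sy Sr r_gt0 arclength biharmonic.
assert (flux_const : forall i s, (i < 2)%nat -> in_interval a b s ->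
    Derive (fun t => r t * Derive (curvature_profile x y r i) t) s = 0).
{ intros i s Hi Hs; assert (Hr := r_gt0 s Hs).
  assert (E := biharmonic i s 0 ltac:(lia) Hs).
  rewrite (Hc_separated x y r i ltac:(lia)), lapl_separated, radial_lapl_scal in E.
  assert (E1 : radial_lapl r (curvature_profile x y r i) s = 0).
  { destruct i as [| [| i]]; [| | lia]; unfold angular in E;
      rewrite Derive_Derive_const in E; lra. }
  unfold radial_lapl at 1 in E1; apply Rmult_integral in E1; destruct E1 as [E1 | E1];
    [exfalso; revert E1; apply Rinv_neq_0_compat; lra | exact E1]. }
assert (flux_w : forall s, in_interval a b s ->
    Derive (fun t => r t * Derive (normal_radial r) t) s = normal_radial r s / r s).
{ intros s Hs; assert (Hr := r_gt0 s Hs).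
  (* At angle 0 the cosine component has factor 1, which isolates the equation for w. *)
  assert (E := biharmonic 2%nat s 0 ltac:(lia) Hs).
  rewrite (Hc_separated x y r 2 ltac:(lia)), lapl_separated, radial_lapl_scal in E.
  simpl curvature_profile in E; unfold angular in E; rewrite Derive_Derive_cos, cos_0 in E.
  unfold radial_lapl in E.
  apply (Rmult_eq_reg_l (/ r s)); [| apply Rinv_neq_0_compat; lra].
  set (D := Derive _ s) in *; set (W := normal_radial r s) in *.
  transitivity (W / r s ^ 2); [lra | field; lra]. }
assert (Dr : forall s, in_interval a b s -> is_derive r s (Derive r s))
  by (intros s Hs; exact (smooth_on_derive a b r 0 s Sr Hs)).
assert (Dw : forall s, in_interval a b s -> is_derive (normal_radial r) s
    (Derive (radial_lapl r r) s + Derive r s / r s ^ 2)).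
{ intros s Hs; assert (Hr := r_gt0 s Hs).
  apply (is_derive_ext_loc (fun s => radial_lapl r r s - / r s)).
  { generalize (locally_in_interval a b s Hs); apply filter_imp; intros t Ht.
    assert (Hr' := r_gt0 t Ht); unfold normal_radial; simpl; field; lra. }
  assert (D := is_derive_radial_lapl a b r r Sr Sr r_gt0 s Hs).
  apply ex_intro, Derive_correct in D; revert D.
  generalize (radial_lapl r r); intros L D; assert (Dr' := Dr s Hs).
  auto_derive; [repeat split; try (eexists; eassumption); lra |].
  change (Derive (fun x => r x) s) with (Derive r s).
  change (Derive (fun x => L x) s) with (Derive L s); field; lra. }
assert (Ew1 : forall s, in_interval a b s -> ex_derive (fun t => r t * Derive (normal_radial r) t) s).
{ intros s Hs; assert (Hr := r_gt0 s Hs).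
  apply (ex_derive_eq_on_interval a b _
    (fun t => r t * Derive (radial_lapl r r) t + Derive r t / r t)); [| exact Hs |].
  { intros t Ht; assert (Hr' := r_gt0 t Ht).
    rewrite (is_derive_unique _ _ _ (Dw t Ht)); field; lra. }
  apply (ex_derive_plus (V := R_NormedModule)).
  - exact (ex_derive_radial_derive a b r r Sr Sr r_gt0 s Hs).
  - apply ex_derive_div; [eexists; exact (smooth_on_derive a b r 1 s Sr Hs)
      | eexists; apply Dr, Hs | lra]. }
assert (flat : forall s, in_interval a b s ->
    radial_lapl r x s = 0 /\ radial_lapl r y s = 0 /\ normal_radial r s = 0).
{ intros s0 Hs0.
  (* As d/dt = r d/ds, each t-derivative is supplied as r times the s-derivative. *)
  apply (reduced_system_flat a b
    (fun s => r s * Derive x s) (fun s => r s * Derive y s) (fun s => r s * Derive r s) r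
    (radial_lapl r x) (radial_lapl r y) (normal_radial r)
    (fun s => r s * Derive (radial_lapl r x) s) (fun s => r s * Derive (radial_lapl r y) s)
    (fun s => r s * Derive (normal_radial r) s)); try assumption;
    clear s0 Hs0; intros s Hs; assert (Hr := r_gt0 s Hs).
  - replace (r s * radial_lapl r x s) with (Derive (fun t => r t * Derive x t) s)
      by (unfold radial_lapl; field; lra).
    apply Derive_correct; eexists; exact (is_derive_radial a b r x Sr Sx s Hs).
  - replace (r s * radial_lapl r y s) with (Derive (fun t => r t * Derive y t) s)
      by (unfold radial_lapl; field; lra).
    apply Derive_correct; eexists; exact (is_derive_radial a b r y Sr Sy s Hs).
  - replace (r s * normal_radial r s + 1) with (Derive (fun t => r t * Derive r t) s)
      by (unfold normal_radial, radial_lapl; field; lra).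
    apply Derive_correct; eexists; exact (is_derive_radial a b r r Sr Sr s Hs).
  - replace (r s * Derive r s / r s) with (Derive r s) by (field; lra); apply Dr, Hs.
  - replace (r s * Derive (radial_lapl r x) s / r s) with (Derive (radial_lapl r x) s)
      by (field; lra).
    apply Derive_correct; eexists; exact (is_derive_radial_lapl a b r x Sr Sx r_gt0 s Hs).
  - replace (r s * Derive (radial_lapl r y) s / r s) with (Derive (radial_lapl r y) s)
      by (field; lra).
    apply Derive_correct; eexists; exact (is_derive_radial_lapl a b r y Sr Sy r_gt0 s Hs).
  - replace (r s * Derive (normal_radial r) s / r s) with (Derive (normal_radial r) s)
      by (field; lra).
    apply Derive_correct; eexists; exact (Dw s Hs).
  - rewrite <- (flux_const 0%nat s ltac:(lia) Hs).
    apply Derive_correct; exact (ex_derive_radial_derive a b r x Sr Sx r_gt0 s Hs).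
  - rewrite <- (flux_const 1%nat s ltac:(lia) Hs).
    apply Derive_correct; exact (ex_derive_radial_derive a b r y Sr Sy r_gt0 s Hs).
  - rewrite <- (flux_w s Hs); apply Derive_correct, Ew1, Hs.
  - transitivity (r s ^ 2 * (Derive x s ^ 2 + Derive y s ^ 2 + Derive r s ^ 2 - 1)); [ring |].
    rewrite (arclength s Hs); ring. }
intros i s th Hi Hs; rewrite (Hc_separated x y r i Hi).
destruct (flat s Hs) as [Hx [Hy Hw]].
destruct i as [| [| i]]; simpl curvature_profile; rewrite ?Hx, ?Hy, ?Hw; ring.
Qed.
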